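(* Let $G_n^6$ be the ladder $P_2\square P_n$ (vertices $v_i,w_i$, $i=1,\dots,n$; edges $v_iv_{i+1},w_iw_{i+1}$ for $i<n$ and $v_iw_i$), and let $\widetilde{G}_n^6$ be obtained from it by adding, for each vertex $x$, a new vertex $x'$ adjacent only to $x$. Then $$\lim_{n\to\infty}\mathcal{I}(\widetilde{G}_n^6)=\frac{4r^2+3r-3}{2(3r^2+2r-3)},\qquad r=1+\frac{12+\sqrt[3]{54(-5+3i\sqrt{111})}}{3\sqrt[3]{27+3i\sqrt{111}}},$$ where the cube roots are principal cube roots.
   Context: For a finite simple graph $G$: a matching is a set of pairwise vertex-disjoint edges; it is maximal if not contained in a larger matching. $\nu(G)$ is the maximum matching size, $\mathcal{T}_0(G)$ the number of maximal matchings, $\mathcal{T}_1(G)$ the sum of the sizes of all maximal matchings, and $\mathcal{I}(G)=\frac{\mathcal{T}_1(G)}{\nu(G)\mathcal{T}_0(G)}$ (equal to $1$ by convention if $\nu(G)=0$). *)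

(* Defs.v *)
From HB Require Import structures.
From mathcomp Require Import all_boot all_order all_algebra.
From mathcomp Require Import complex.
From mathcomp Require Import all_classical all_reals all_analysis.
Set Implicit Arguments.
Unset Strict Implicit.
Unset Printing Implicit Defensive.
Import Order.TTheory GRing.Theory Num.Theory.
Import numFieldNormedType.Exports.

Local Open Scope ring_scope.

Record sgraph := SGraph {
  vertex :> finType;
  adj : rel vertex;
  adj_sym : symmetric adj;
  adj_irrefl : irreflexive adj
}.

Section Matchings.
Variable G : sgraph.

Definition edges : {set {set G}} :=
  [set [set p.1; p.2] | p : G * G & adj p.1 p.2]%SET.

Definition matching (M : {set {set G}}) : bool :=
  (M \subset edges) && finset.trivIset M.

Definition maximal_matching (M : {set {set G}}) : bool := maxset matching M.

Definition nu : nat := \max_(M : {set {set G}} | matching M) #|M|.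

Definition T0 : nat := #|[set M : {set {set G}} | maximal_matching M]%SET|.

Definition T1 : nat := (\sum_(M : {set {set G}} | maximal_matching M) #|M|)%N.

Definition Iratio (R : realType) : R :=
  if nu == 0%N then 1 else T1%:R / (nu%:R * T0%:R).

End Matchings.

Section Path.
Variable n : nat.

Definition path_adj : rel 'I_n :=
  fun i j => (i.+1 == j :> nat) || (j.+1 == i :> nat).

Lemma path_adj_sym : symmetric path_adj.
Proof. by move=> i j; rewrite /path_adj orbC. Qed.

Lemma path_adj_irrefl : irreflexive path_adj.
Proof. by move=> i; rewrite /path_adj orbb gtn_eqF. Qed.

Definition path_graph : sgraph := SGraph path_adj_sym path_adj_irrefl.

End Path.

Section BoxProduct.
Variables G H : sgraph.

Definition box_adj : rel (G * H)%type := fun x y =>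
  (adj x.1 y.1 && (x.2 == y.2)) || ((x.1 == y.1) && adj x.2 y.2).

Lemma box_adj_sym : symmetric box_adj.
Proof.
by move=> x y; rewrite /box_adj adj_sym (eq_sym x.2) (eq_sym x.1) (adj_sym x.2).
Qed.

Lemma box_adj_irrefl : irreflexive box_adj.
Proof. by move=> x; rewrite /box_adj !adj_irrefl andbF. Qed.

Definition box_product : sgraph := SGraph box_adj_sym box_adj_irrefl.

End BoxProduct.

Section Pendant.
Variable G : sgraph.

(* inr x is the new vertex x', whose only neighbour is inl x. *)
Definition pendant_adj : rel (G + G)%type := fun a b =>
  match a, b with
  | inl x, inl y => adj x y
  | inl x, inr y | inr x, inl y => x == y
  | inr _, inr _ => false
  end.

Lemma pendant_adj_sym : symmetric pendant_adj.
Proof. by case=> x [] y //=; rewrite adj_sym. Qed.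

Lemma pendant_adj_irrefl : irreflexive pendant_adj.
Proof. by case=> x //=; rewrite adj_irrefl. Qed.

Definition pendant_graph : sgraph := SGraph pendant_adj_sym pendant_adj_irrefl.

End Pendant.

(* v_i and w_i, 1 <= i <= n, are the pairs (0, i - 1) and (1, i - 1). *)
Definition ladder (n : nat) : sgraph :=
  box_product (path_graph 2) (path_graph n).

Section PrincipalCubeRoot.
Variable R : realType.
Local Open Scope complex_scope.

Definition cmod (z : R[i]) : R :=
  let: a +i* b := z in Num.sqrt (a ^+ 2 + b ^+ 2).

(* The argument in ]-pi, pi]; its value at 0 is irrelevant. *)
Definition carg (z : R[i]) : R :=
  let: a +i* b := z in
  let t := acos (a / cmod z) in if 0 <= b then t else - t.

Definition principal_cbrt (z : R[i]) : R[i] :=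
  let rho := cmod z `^ 3^-1 in
  let theta := carg z / 3 in
  (rho * cos theta) +i* (rho * sin theta).

End PrincipalCubeRoot.

(* Main.v *)
(** Every maximal matching of the pendant graph of [G] covers all vertices of [G], so
    it is a matching [M] of [G] completed by the pendant edges at the vertices missed by
    [M]; its size is [|V(G)| - |M|], and the maximum size is [|V(G)|].  Hence the ratio
    for the ladder is [1 - d_n / (2 n m_n)], where [m_n] and [d_n] are the values at
    [x = 1] of the matching generating polynomial of the ladder and of its derivative.

    Deleting vertices at the end of the ladder gives
    [A_{n+3} = (1 + 2x) A_{n+2} + x A_{n+1} - x^3 A_n] for this polynomial.  At [x = 1]
    the characteristic polynomial [r^3 - 3 r^2 - r + 1] has a dominant root [r] and two
    roots in the open unit disk, so [m_n] grows like [r^n], and differentiating the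
    characteristic equation in [x] gives the limit [c] of [d_n / (n m_n)]; precisely,
    [d_n - c n m_n = O(r^n)].

    With [r = 1 + s] the equation becomes [s^3 = 4 s + 2].  Let [w] be the principal
    cube root of [27 + 3 i sqrt 111].  Then [|w|^2 = 12] and the other cube root in the
    statement is [w^2], so the formula reads [s = (12 + w^2) / (3 w) = (w + conj w) / 3],
    the trigonometric form of the positive root. *)
Require Import Defs.
From mathcomp Require Import all_boot all_order all_algebra ring lra zify.
Import Order.TTheory GRing.Theory Num.Theory.
Local Open Scope ring_scope.

(** * Matchings of a graph and of its pendant graph *)

Section MatchingPolynomial.
Variable G : sgraph.
Implicit Types (M N : {set {set G}}) (e : {set G}) (u v : G).

Lemma mem_edges_set2 u v : ([set u; v] \in edges G) = adj u v.
Proof.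
apply/imsetP/idP => [[[a b] /=]|uv]; last by exists (u, v); rewrite ?inE.
rewrite inE /= => ab E.
have aNb : a != b by apply: contraTneq ab => ->; rewrite adj_irrefl.
have : u \in [set a; b] by rewrite -E set21.
have : v \in [set a; b] by rewrite -E set22.
have /set2P au : a \in [set u; v] by rewrite E set21.
have /set2P bu : b \in [set u; v] by rewrite E set22.
case/set2P => Ev /set2P[] Eu; rewrite Eu Ev // in au bu *.
- by case: bu aNb => ->; rewrite eqxx.
- by rewrite adj_sym.
- by case: au aNb => ->; rewrite eqxx.
Qed.

Lemma edgesP e : reflect (exists u v, adj u v /\ e = [set u; v]) (e \in edges G).
Proof.
apply: (iffP idP) => [/imsetP[[u v] /= uv ->]|[u [v [uv ->]]]].
  by exists u, v; rewrite inE in uv.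
by rewrite mem_edges_set2.
Qed.

Lemma card_edge e : e \in edges G -> #|e| = 2.
Proof.
case/edgesP=> u [v [uv ->]]; rewrite cards2; case: eqVneq => // E.
by rewrite E adj_irrefl in uv.
Qed.

Lemma matchingP M :
  reflect ({subset M <= edges G} /\
           forall e1 e2 u, e1 \in M -> e2 \in M -> u \in e1 -> u \in e2 -> e1 = e2)
          (matching M).
Proof.
apply: (iffP andP) => [[/subsetP sM /finset.trivIsetP tM]|[sM tM]].
  split=> // e1 e2 u e1M e2M ue1 ue2; case: (eqVneq e1 e2) => // ne.
  by have /pred0Pn[] := tM _ _ e1M e2M ne; exists u; rewrite /= ue1.
split; first exact/subsetP.
apply/finset.trivIsetP => e1 e2 e1M e2M; apply: contraNT => /pred0Pn[u /= /andP[ue1 ue2]].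
by apply/eqP; apply: tM ue1 ue2.
Qed.

Lemma matching0 : matching (set0 : {set {set G}}).
Proof. by apply/matchingP; split=> [e|e1 e2 u]; rewrite inE. Qed.

Lemma matchingU1 M u v : adj u v -> [set u; v] \notin M ->
  matching ([set u; v] |: M) =
  [&& matching M, u \notin finset.cover M & v \notin finset.cover M].
Proof.
move=> uv eM; apply/idP/and3P => [/matchingP[sM tM]|[/matchingP[sM tM] uM vM]].
  split.
  - apply/matchingP; split=> [e eM'|e1 e2 w e1M e2M]; first by rewrite sM ?setU1r.
    by apply: tM; rewrite setU1r.
  - apply/negP => /bigcupP[e eM' ue]; case/negP: eM.
    by rewrite (tM [set u; v] e u (setU11 _ _) (setU1r _ eM') (set21 _ _)).
  - apply/negP => /bigcupP[e eM' ve]; case/negP: eM.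
    by rewrite (tM [set u; v] e v (setU11 _ _) (setU1r _ eM') (set22 _ _)).
have disj e w : e \in M -> w \in [set u; v] -> w \in e -> False.
  move=> eM' /set2P[] -> we; [case/negP: uM|case/negP: vM]; by apply/bigcupP; exists e.
apply/matchingP; split=> [e /setU1P[->|/sM //]|e1 e2 w]; first by rewrite mem_edges_set2.
move=> /setU1P[->|e1M] /setU1P[->|e2M] // w1 w2.
- by case: (disj e2 w).
- by case: (disj e1 w).
- exact: tM w1 w2.
Qed.

Lemma card_cover_matching M : matching M -> #|finset.cover M| = (#|M| * 2)%N.
Proof.
move=> mM; have /andP[/subsetP sM /eqP <-] := mM.
by rewrite -sum_nat_const; apply: eq_bigr => e /sM /card_edge.
Qed.

Section Polynomial.
Variables (R : comPzRingType) (x : R).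

(** The matching generating polynomial, at [x], of the subgraph induced on [W]. The graph stays
    fixed, so that deleting vertices only shrinks [W]. *)
Definition matching_sum (W : {set G}) : R :=
  \sum_(M | matching M && (finset.cover M \subset W)) x ^+ #|M|.

Lemma matching_sum0 : matching_sum set0 = 1.
Proof.
rewrite /matching_sum (big_pred1 set0) ?cards0 ?expr0 // => M /=.
apply/andP/eqP => [[mM /subset_leq_card]|->].
  by rewrite cards0 card_cover_matching // leqn0 muln_eq0 orbF cards_eq0 => /eqP.
by rewrite /finset.cover big_set0 sub0set matching0.
Qed.

(** A matching either misses [v] or matches it to exactly one neighbour [u]; in the second case,
    removing that edge leaves a matching of [W] without [v] and [u]. *)
Lemma matching_sum_del (W : {set G}) v : v \in W ->
  matching_sum W = matching_sum (W :\ v)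
    + x * \sum_(u in [set u in W | adj v u]) matching_sum (W :\ v :\ u).
Proof.
move=> vW; rewrite {1}/matching_sum (bigID (fun M => v \in finset.cover M)) /= addrC.
congr (_ + _); first by apply: eq_bigl => M; rewrite subsetD1 andbA.
(* The inner sum has a single term, the partner of [v] in [M]; the two sums can then be
   exchanged. *)
transitivity (\sum_(M | matching M && (finset.cover M \subset W) && (v \in finset.cover M))
   \sum_(u in [set u in W | adj v u] | [set v; u] \in M) x ^+ #|M|).
  apply: eq_bigr => M /andP[/andP[mM sMW] /bigcupP[e eM ve]].
  have /matchingP[sM tM] := mM.
  have [u [vu Ee]] : exists u, adj v u /\ e = [set v; u].
    have /edgesP[a [b [ab Ee]]] := sM _ eM.
    move: ve; rewrite Ee => /set2P[] E; first by exists b; rewrite E.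
    by exists a; rewrite E adj_sym setUC.
  rewrite (big_pred1 u) // => w /=; rewrite inE; apply/andP/eqP => [[/andP[wW vw] wM]|->].
    have E : [set v; w] = [set v; u] by rewrite -Ee; apply: (tM _ _ v); rewrite ?set21.
    have : w \in [set v; u] by rewrite -E set22.
    by case/set2P => // wv; rewrite wv adj_irrefl in vw.
  rewrite -Ee eM vu andbT; split=> //; apply: (subsetP sMW).
  by apply/bigcupP; exists e; rewrite // Ee set22.
rewrite (exchange_big_dep (fun u => u \in [set u in W | adj v u])) //=; last first.
  by move=> M u _ /andP[].
rewrite mulr_sumr; apply: eq_bigr => u; rewrite inE => /andP[uW vu].
rewrite uW vu /= /matching_sum mulr_sumr.
have vNu : u != v by apply: contraTneq vu => ->; rewrite adj_irrefl.
rewrite (reindex_onto (fun M => [set v; u] |: M) (fun M => M :\ [set v; u])) /=; last first.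
  by move=> M /andP[_ eM]; rewrite setD1K.
apply: eq_big => [M|M /andP[_ /eqP E]]; last first.
  by rewrite cardsU1 -E setD11 exprS.
rewrite setU11 andbT !subsetD1.
(* If [M] already contains the edge, adding and removing it does not give back [M], and [M] covers
   [v]: both index conditions fail. *)
case: (boolP ([set v; u] \in M)) => eM.
  have -> : ([set v; u] |: M) :\ [set v; u] == M = false.
    by apply/eqP => E; rewrite -E setD11 in eM.
  rewrite andbF; apply/esym/negbTE/negP => /andP[_ /andP[/andP[_ /negP vM] _]]; apply: vM.
  by apply/bigcupP; exists [set v; u]; rewrite ?set21.
rewrite setU1K // eqxx andbT matchingU1 //.
have -> : finset.cover ([set v; u] |: M) = [set v; u] :|: finset.cover M.
  by rewrite /finset.cover bigcup_setU big_set1.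
by rewrite subUset subUset !sub1set vW uW !inE eqxx /= andbT -!andbA; do !bool_congr.
Qed.

End Polynomial.

End MatchingPolynomial.

(** * Maximal matchings of the pendant graph *)

Section PendantMatchings.
Variable G : sgraph.
Implicit Types (M : {set {set G}}) (N : {set {set pendant_graph G}}).

Let inlG (x : G) : pendant_graph G := inl x.
Let inrG (x : G) : pendant_graph G := inr x.
Let lift_edge (e : {set G}) : {set pendant_graph G} := inlG @: e.
Let leaf_edge (x : G) : {set pendant_graph G} := [set inlG x; inrG x].

Let inlG_inj : injective inlG. Proof. by move=> x y []. Qed.
Let lift_edge_inj : injective lift_edge. Proof. exact: imset_inj. Qed.
Let leaf_edge_inj : injective leaf_edge.
Proof.
move=> x y E; have : inrG x \in leaf_edge y by rewrite -E set22.
by case/set2P => [|[]].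
Qed.
Let lift_edge2 x y : lift_edge [set x; y] = [set inlG x; inlG y].
Proof. by rewrite /lift_edge imsetU !imset_set1. Qed.
Let mem_lift x e : (inlG x \in lift_edge e) = (x \in e).
Proof. by rewrite mem_imset. Qed.
Let inr_lift x e : inrG x \in lift_edge e = false.
Proof. by apply/imsetP => -[]. Qed.
Let inl_leaf x y : inlG x \in leaf_edge y = (x == y).
Proof. by rewrite !inE /= orbF. Qed.
Let inr_leaf x y : inrG x \in leaf_edge y = (x == y).
Proof. by rewrite !inE /=. Qed.

Definition pendant_matching M : {set {set pendant_graph G}} :=
  (lift_edge @: M) :|: (leaf_edge @: ~: finset.cover M).
Definition core_matching N : {set {set G}} := [set e | lift_edge e \in N].

Let leaf_neq_lift x e : leaf_edge x <> lift_edge e.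
Proof. by move=> E; move: (inr_lift x e); rewrite -E inr_leaf eqxx. Qed.

Lemma pendant_edgesP e :
  e \in edges (pendant_graph G) ->
  (exists2 e', e' \in edges G & e = lift_edge e') \/ (exists x, e = leaf_edge x).
Proof.
case/edgesP=> -[x|x] [[y|y] [/= xy ->]] //.
- by left; exists [set x; y]; rewrite ?mem_edges_set2 ?lift_edge2.
- by right; exists x; rewrite (eqP xy).
- by right; exists x; rewrite (eqP xy) setUC.
Qed.

Lemma leaf_edge_in x : leaf_edge x \in edges (pendant_graph G).
Proof. by rewrite mem_edges_set2 /= eqxx. Qed.

Lemma lift_edge_in e : (lift_edge e \in edges (pendant_graph G)) = (e \in edges G).
Proof.
apply/idP/idP => [/pendant_edgesP[[e' ee' /lift_edge_inj -> //]|[x /esym /leaf_neq_lift //]]|].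
by case/edgesP=> u [v [uv ->]]; rewrite lift_edge2 mem_edges_set2.
Qed.

Lemma lift_in_pendant M e : (lift_edge e \in pendant_matching M) = (e \in M).
Proof.
rewrite in_setU mem_imset //; case: (e \in M) => //=.
by apply/imsetP => -[x _ /esym /leaf_neq_lift].
Qed.

Lemma leaf_in_pendant M x : (leaf_edge x \in pendant_matching M) = (x \notin finset.cover M).
Proof.
rewrite in_setU [X in _ || X]mem_imset // in_setC; case: (x \in finset.cover M) => //=.
  by rewrite orbF; apply/imsetP => -[e _ /leaf_neq_lift].
by rewrite orbT.
Qed.

Lemma pendant_matchingK : cancel pendant_matching core_matching.
Proof. by move=> M; apply/setP => e; rewrite inE lift_in_pendant. Qed.

Lemma matching_core N : matching N -> matching (core_matching N).
Proof.
move=> /matchingP[sN tN]; apply/matchingP; split=> [e|e1 e2 u].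
  by rewrite inE => /sN; rewrite lift_edge_in.
rewrite !inE => e1N e2N u1 u2; apply: lift_edge_inj.
by apply: (tN _ _ (inlG u)); rewrite ?mem_lift.
Qed.

Lemma matching_pendant M : matching M -> matching (pendant_matching M).
Proof.
move=> /matchingP[sM tM]; apply/matchingP; split=> [e|e1 e2 u].
  case/setUP => /imsetP[e' e'M ->]; last exact: leaf_edge_in.
  by rewrite lift_edge_in sM.
case/setUP => /imsetP[a aM ->]; case/setUP => /imsetP[b bM ->]; case: u => u.
- rewrite !mem_lift => ua ub; congr lift_edge; exact: tM ua ub.
- by rewrite inr_lift.
- rewrite mem_lift inl_leaf => ua /eqP E; move: bM; rewrite in_setC => /negP[]; rewrite -E.
  by apply/bigcupP; exists a.
- by rewrite inr_lift.
- rewrite mem_lift inl_leaf => /eqP E ub; move: aM; rewrite in_setC => /negP[]; rewrite -E.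
  by apply/bigcupP; exists b.
- by rewrite inr_lift.
- by rewrite !inl_leaf => /eqP <- /eqP <-.
- by rewrite !inr_leaf => /eqP <- /eqP <-.
Qed.

(** Every edge of the pendant graph has an end [inlG x], and each such vertex already carries an
    edge of [pendant_matching M]; in a larger matching the two edges coincide. *)
Lemma maximal_pendant M : matching M -> maximal_matching (pendant_matching M).
Proof.
move=> mM; apply/maxsetP; split=> [|N mN sub]; first exact: matching_pendant.
apply/eqP; rewrite eqEsubset sub andbT; apply/subsetP => e eN.
have /matchingP[sN tN] := mN.
have key x : inlG x \in e -> e \in pendant_matching M.
  move=> xe; case: (boolP (x \in finset.cover M)) => [/bigcupP[e' e'M xe']|xM].
    have e'P : lift_edge e' \in pendant_matching M by rewrite lift_in_pendant.
    by rewrite (tN e (lift_edge e') (inlG x)) ?mem_lift // (subsetP sub).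
  have lP : leaf_edge x \in pendant_matching M by rewrite leaf_in_pendant.
  by rewrite (tN e (leaf_edge x) (inlG x)) ?inl_leaf // (subsetP sub).
case: (pendant_edgesP _ (sN _ eN)) => [[e' /edgesP[u [v [_ ->]]]]|[x]] E.
  by apply: (key u); rewrite E mem_lift set21.
by apply: (key x); rewrite E inl_leaf.
Qed.

(** By maximality of [N] it suffices that the completion of its core contains [N]: a leaf edge of
    [N] at [x] excludes a core edge at [x]. *)
Lemma core_matchingK N : maximal_matching N -> pendant_matching (core_matching N) = N.
Proof.
move=> /maxsetP[mN max]; have /matchingP[sN tN] := mN.
apply: max; first by apply: matching_pendant; apply: matching_core.
apply/subsetP => e eN; case: (pendant_edgesP _ (sN _ eN)) => [[e' _]|[x]] E.
  by rewrite E lift_in_pendant inE -E.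
rewrite E leaf_in_pendant; apply/negP => /bigcupP[e']; rewrite inE => e'N xe'.
apply: (@leaf_neq_lift x e'); rewrite -E; apply: (tN _ _ (inlG x)) => //.
  by rewrite E inl_leaf.
by rewrite mem_lift.
Qed.

Lemma card_pendant_matching M : matching M -> (#|pendant_matching M| + #|M| = #|G|)%N.
Proof.
move=> mM; rewrite cardsU disjoint_setI0 ?cards0 ?subn0; last first.
  apply/pred0P => e /=; apply/andP => -[/imsetP[a _ ->] /imsetP[b _]].
  by move/esym/leaf_neq_lift.
rewrite !card_imset // -(cardsC (finset.cover M)) card_cover_matching //.
by rewrite muln2 -addnn addnAC.
Qed.

(** Serves both counts: [F] constant gives [T0], [F] the identity gives [T1]. *)
Lemma sum_maximal_pendant (A : nmodType) (F : nat -> A) :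
  \sum_(N | maximal_matching (G := pendant_graph G) N) F #|N| =
  \sum_(M | matching (G := G) M) F (#|G| - #|M|)%N.
Proof.
rewrite (reindex_onto pendant_matching core_matching core_matchingK).
apply: eq_big => [M|M /andP[maxM _]].
  rewrite pendant_matchingK eqxx andbT; apply/idP/idP => [|/maximal_pendant //].
  by move/maxsetp/matching_core; rewrite pendant_matchingK.
have mM : matching M by rewrite -[M]pendant_matchingK matching_core // (maxsetp maxM).
by rewrite -(card_pendant_matching _ mM) addnK.
Qed.

Lemma T0_pendant : T0 (pendant_graph G) = (\sum_(M | matching (G := G) M) 1)%N.
Proof.
rewrite /T0 -sum1_card -[RHS](sum_maximal_pendant _ (fun=> 1%N)).
by apply: eq_bigl => N; rewrite inE.
Qed.

Lemma T1_pendant :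
  T1 (pendant_graph G) = (\sum_(M | matching (G := G) M) (#|G| - #|M|))%N.
Proof. exact: (sum_maximal_pendant _ id). Qed.

Lemma nu_pendant : nu (pendant_graph G) = #|G|.
Proof.
apply/eqP; rewrite eqn_leq; apply/andP; split.
  apply/bigmax_leqP => N mN; have [N' maxN' sub] := maxset_exists mN.
  apply: leq_trans (subset_leq_card sub) _.
  rewrite -(card_pendant_matching (core_matching N')) ?core_matchingK ?leq_addr //.
  exact: matching_core (maxsetp maxN').
rewrite -(card_pendant_matching _ (matching0 G)) cards0 addn0.
exact: (leq_bigmax_cond (F := fun N => #|N|) _ (matching_pendant _ (matching0 G))).
Qed.

Lemma card_leq_matching M : matching M -> (#|M| <= #|G|)%N.
Proof. by move=> mM; rewrite -(card_pendant_matching M) // leq_addl. Qed.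

End PendantMatchings.

(** * Matchings of the ladder *)

Section LadderMatchings.
Variables (R : comNzRingType) (x : R).

(* The triple [(a, b, a1)] at [n] consists of the matching sums of the ladder with [n]
   rungs, of the same ladder with one row extended by a vertex, and of the ladder with
   [n.+1] rungs. *)
Fixpoint ladder_sums n : R * R * R :=
  if n is n'.+1 then
    let: (a, b, a1) := ladder_sums n' in
    (a1, a1 + x * b, (a1 + x * b) + x * (b + x * a + a1))
  else (1, 1, 1 + x).

Definition ladder_sum n : R := (ladder_sums n).1.1.

(** The Cayley-Hamilton relation of the linear step of [ladder_sums]; it holds from an arbitrary
    triple, hence without induction. *)
Lemma ladder_sum_rec n :
  ladder_sum n.+3 =
  (1 + 2 * x) * ladder_sum n.+2 + x * ladder_sum n.+1 - x ^+ 3 * ladder_sum n.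
Proof.
by rewrite /ladder_sum /=; case: (ladder_sums n) => -[a b] a1 /=; ring.
Qed.

Section Staircase.
Variable n : nat.
Implicit Types (i : 'I_2) (a b : nat).

(** Regions left by deleting vertices from the right end; the parameter [i] lets one deletion rule
    serve both rows. *)
Definition staircase i a b : {set ladder n} :=
  [set p : 'I_2 * 'I_n | p.2 < (if p.1 == i then a else b)]%N.

Lemma in_staircase i a b (j : 'I_2) (l : 'I_n) :
  ((j, l) \in staircase i a b) = (l < (if j == i then a else b))%N.
Proof. by rewrite inE. Qed.

Lemma ladder_eqE i (k : 'I_n) j (l : 'I_n) :
  ((j, l) == (i, k) :> ladder n) = (j == i) && (l == k :> nat).
Proof. by []. Qed.

Lemma staircase_full i : staircase i n n = setT.
Proof. by apply/setP => -[j k]; rewrite in_staircase inE if_same ltn_ord. Qed.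

Lemma staircase0 i : staircase i 0 0 = set0.
Proof. by apply/setP => -[j k]; rewrite in_staircase inE if_same. Qed.

Lemma ord2_neq i j : (j == rev_ord i) = (j != i).
Proof. by case: i j => [[|[|?]] ?] [[|[|?]] ?]. Qed.

Lemma staircase_swap i a b : staircase i a b = staircase (rev_ord i) b a.
Proof. by apply/setP => -[j l]; rewrite !in_staircase ord2_neq if_neg. Qed.

Lemma staircase_del i k b (kn : (k < n)%N) :
  staircase i k.+1 b :\ (i, Ordinal kn) = staircase i k b.
Proof.
apply/setP => -[j l]; rewrite in_setD1 !in_staircase ladder_eqE /=.
by case: (j == i) => //=; lia.
Qed.

Let Q i a b := matching_sum _ _ x (staircase i a b).

Lemma ladder_adjE i j (k l : 'I_n) : @adj (ladder n) (i, k) (j, l) =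
  (j != i) && (l == k :> nat) || (j == i) && ((k.+1 == l) || (l.+1 == k)).
Proof.
rewrite /= /box_adj /= /path_adj (eq_sym k) (eq_sym i).
by congr (_ && _ || _); case: i j => [[|[|?]] ?] [[|[|?]] ?].
Qed.

Lemma top_in_staircase i k b (kn : (k < n)%N) : (i, Ordinal kn) \in staircase i k.+1 b.
Proof. by rewrite in_staircase eqxx. Qed.

Lemma sum_staircase1 i (n0 : (0 < n)%N) : Q i 1 0 = 1.
Proof.
rewrite /Q (matching_sum_del _ _ _ _ _ (top_in_staircase i 0 0 n0)) staircase_del.
rewrite staircase0 matching_sum0 big_pred0 ?mulr0 ?addr0 // => -[j l].
rewrite inE in_staircase ladder_adjE /=.
by case: (j == i) => //=; lia.
Qed.

Lemma sum_staircase11 i (n0 : (0 < n)%N) : Q i 1 1 = 1 + x.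
Proof.
rewrite /Q (matching_sum_del _ _ _ _ _ (top_in_staircase i 0 1 n0)) staircase_del.
rewrite staircase_swap -/(Q _ _ _) sum_staircase1 //.
rewrite (_ : [set _ in _ | _] = [set (rev_ord i, Ordinal n0)]).
  by rewrite big_set1 staircase_del staircase0 matching_sum0 mulr1.
apply/setP => -[j l]; rewrite inE in_staircase ladder_adjE in_set1 ladder_eqE ord2_neq /=.
by case: (j == i) => //=; lia.
Qed.

(** As [b <= k.+1], the last vertex of row [i] has no rung inside the region: its only neighbour is
    to its left. *)
Lemma sum_staircase_step i k b : (k.+1 < n)%N -> (b <= k.+1)%N ->
  Q i k.+2 b = Q i k.+1 b + x * Q i k b.
Proof.
move=> kn bk; rewrite /Q (matching_sum_del _ _ _ _ _ (top_in_staircase i k.+1 b kn)) staircase_del.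
congr (_ + x * _); rewrite (_ : [set _ in _ | _] = [set (i, Ordinal (ltnW kn))]).
  by rewrite big_set1 staircase_del.
apply/setP => -[j l]; rewrite inE in_staircase ladder_adjE in_set1 ladder_eqE /=.
by case: (j == i) => //=; lia.
Qed.

(** The corner vertex has two neighbours, one to its left and one across the rung. *)
Lemma sum_staircase_level i k : (k.+1 < n)%N ->
  Q i k.+2 k.+2 = Q i k.+1 k.+2 + x * (Q i k k.+2 + Q i k.+1 k.+1).
Proof.
move=> kn; rewrite /Q (matching_sum_del _ _ _ _ _ (top_in_staircase i k.+1 k.+2 kn)) staircase_del.
congr (_ + x * _).
rewrite (_ : [set _ in _ | _] = [set (i, Ordinal (ltnW kn)); (rev_ord i, Ordinal kn)]).
  rewrite big_setU1 ?big_set1 /=; last by rewrite inE ladder_eqE ord2_neq eqxx.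
  by rewrite staircase_del [X in X :\ _]staircase_swap staircase_del -staircase_swap.
apply/setP => -[j l]; rewrite inE in_staircase ladder_adjE in_set2 !ladder_eqE ord2_neq /=.
by case: (j == i) => //=; lia.
Qed.

Lemma ladder_sumsE i k : (k < n)%N ->
  ladder_sums k = (Q i k k, Q i k.+1 k, Q i k.+1 k.+1).
Proof.
elim: k i => [|k IH] i kn.
  by rewrite sum_staircase1 // sum_staircase11 // /Q staircase0 matching_sum0.
(* The induction hypothesis covers both rows and [ladder_sums] does not mention the row, which gives
   the symmetry between rows. *)
have E j : Q i k.+1 k = Q j k.+1 k.
  by have := IH i (ltnW kn); rewrite (IH j (ltnW kn)) => -[].
have S a b : Q i a b = Q (rev_ord i) b a by rewrite /Q staircase_swap.
have E0 : Q i k k.+1 = Q i k.+1 k by rewrite S -E.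
have E1 : Q i k.+1 k.+2 = Q i k.+1 k.+1 + x * Q i k.+1 k.
  by rewrite (S k.+1 k.+2) sum_staircase_step // -!S.
have E2 : Q i k k.+2 = Q i k.+1 k + x * Q i k k.
  by rewrite (S k k.+2) sum_staircase_step // -(E (rev_ord i)) -S.
by rewrite [LHS]/= (IH i (ltnW kn)) sum_staircase_level // sum_staircase_step // E0 E1 E2.
Qed.

End Staircase.

Lemma ladder_sumE n : ladder_sum n = \sum_(M : {set {set ladder n}} | matching M) x ^+ #|M|.
Proof.
transitivity (matching_sum (ladder n) _ x setT); last first.
  by apply: eq_bigl => M; rewrite subsetT andbT.
rewrite -(staircase_full n ord0); case: n => [|n].
  by rewrite staircase0 matching_sum0.
(* [ladder_sumsE] needs an index below the number of rungs, so the sum for [n.+1] rungs is read from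
   the third component at [n]. *)
rewrite /ladder_sum /=; case: (ladder_sums n) (ladder_sumsE _ ord0 _ (ltnSn n)).
by move=> [a b] a1 /= [_ _ ->].
Qed.

Lemma card_ladder n : #|ladder n| = (2 * n)%N.
Proof. by rewrite card_prod !card_ord. Qed.

End LadderMatchings.

(** * Growth of the recurrences *)

Section Asymptotics.
Variable R : realFieldType.

(** The bound [B] is preserved: 3/4 B + C <= B because 4 C <= B. *)
Lemma contracting_rec_bounded (h : nat -> R) (a b C : R) :
  0 <= a -> 0 <= b -> a + b <= 3 / 4 -> 0 <= C ->
  (forall n, `|h n.+2| <= a * `|h n.+1| + b * `|h n| + C) ->
  forall n, `|h n| <= `|h 0%N| + `|h 1%N| + 4 * C.
Proof.
move=> a0 b0 ab C0 hrec; set B := _ + _ + _.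
have h0 := normr_ge0 (h 0%N); have h1 := normr_ge0 (h 1%N).
suff H n : `|h n| <= B /\ `|h n.+1| <= B by move=> n; case: (H n).
elim: n => [|n [IH0 IH1]]; first by rewrite /B; lra.
split=> //; apply: le_trans (hrec n) _.
have := ler_wpM2l a0 IH1; have := ler_wpM2l b0 IH0.
have : (a + b) * B <= 3 / 4 * B by apply: ler_wpM2r => //; rewrite /B; lra.
rewrite mulrDl /B; lra.
Qed.

Lemma linear_growth_bounded (e : nat -> R) (r H : R) :
  2 <= r -> 0 <= H -> (forall n, `|e n.+1 - r * e n| <= H) ->
  forall n, `|e n| <= (`|e 0%N| + H) * r ^+ n.
Proof.
(* With [H] added the induction closes: r |e n| + 2 H <= r (|e n| + H), since r >= 2. *)
move=> r2 H0 step n; suff : `|e n| + H <= (`|e 0%N| + H) * r ^+ n by lra.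
elim: n => [|n IH]; first by rewrite expr0 mulr1.
have tri : `|e n.+1| <= `|e n.+1 - r * e n| + r * `|e n|.
  rewrite -[X in _ + X * _]ger0_norm; last by lra.
  by rewrite -normrM; apply: le_trans (ler_normD _ _); rewrite subrK.
have := step n; rewrite exprS.
have : r * (`|e n| + H) <= r * ((`|e 0%N| + H) * r ^+ n) by rewrite ler_wpM2l //; lra.
have : 2 * H <= r * H by rewrite ler_wpM2r.
rewrite mulrDr [in X in _ -> X -> _]mulrCA; lra.
Qed.

Variables (m d : nat -> R) (s : R).
Let r := 1 + s.
(** The value r'/r at x = 1 when r^3 = (1 + 2x) r^2 + x r - x^3 is differentiated in x; the
    denominator 3 r^3 - 6 r^2 - r is reduced by the cubic. *)
Let c := (2 * r ^+ 2 + r - 3) / (3 * r ^+ 2 + 2 * r - 3).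

Hypotheses (s_gt0 : 0 < s) (s_cubic : s ^+ 3 = 4 * s + 2).
Hypotheses (m0 : m 0 = 1) (m1 : m 1 = 2) (m2 : m 2 = 7).
Hypothesis m_rec : forall n, m n.+3 = 3 * m n.+2 + m n.+1 - m n.
Hypothesis d_rec : forall n,
  d n.+3 = 3 * d n.+2 + d n.+1 - d n + (2 * m n.+2 + m n.+1 - 3 * m n).

Let r_bounds : 32 / 10 < r < 325 / 100.
Proof.
(* This form of s^3 - 4 s is increasing beyond 2; its values at 2.2 and 2.25 lie on either side of
   2. *)
have E : s * ((s - 2) * (s + 2)) = 2.
  have -> : s * ((s - 2) * (s + 2)) = s ^+ 3 - 4 * s by ring.
  by rewrite s_cubic; ring.
have s2 : 2 < s.
  rewrite ltNge; apply/negP => s2.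
  have : s * ((s - 2) * (s + 2)) <= 0.
    by apply: mulr_ge0_le0; [exact: ltW|]; apply: mulr_le0_ge0; [rewrite subr_le0|
      rewrite addr_ge0 ?ltW].
  by rewrite E; lra.
apply/andP; split; rewrite /r ltNge; apply/negP => sl.
  have : s * ((s - 2) * (s + 2)) <= 22 / 10 * (2 / 10 * (42 / 10)).
    by do 2 (apply: ler_pM; rewrite ?mulr_ge0 //; try lra).
  by rewrite E; lra.
have : 2 * (1 / 4 * (17 / 4)) <= s * ((s - 2) * (s + 2)).
  by do 2 (apply: ler_pM; rewrite ?mulr_ge0 //; try lra).
by rewrite E; lra.
Qed.

Let r_cubic : r ^+ 3 = 3 * r ^+ 2 + r - 1.
Proof.
have -> : r ^+ 3 = s ^+ 3 + 3 * s ^+ 2 + 3 * s + 1 by rewrite /r; ring.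
by rewrite s_cubic /r; ring.
Qed.

Let r_inv : r^-1 = 1 + 3 * r - r ^+ 2.
Proof.
have r0 : r != 0 by move: r_bounds; lra.
apply: (mulfI r0); rewrite divff //.
have -> : r * (1 + 3 * r - r ^+ 2) = r + 3 * r ^+ 2 - r ^+ 3 by ring.
by rewrite r_cubic; ring.
Qed.

(* The quotient of the characteristic polynomial by its root [r] has roots of modulus
   less than 1, which makes [u n.+1 - r * u n] bounded. *)
Lemma deflated_rec (u : nat -> R) (p : nat -> R) :
  (forall n, u n.+3 = 3 * u n.+2 + u n.+1 - u n + p n) ->
  forall n, u n.+3 - r * u n.+2 =
    (3 - r) * (u n.+2 - r * u n.+1) + r^-1 * (u n.+1 - r * u n) + p n.
Proof.
move=> urec n; rewrite urec.
have r0 : r != 0 by move: r_bounds; lra.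
have -> : r^-1 * (u n.+1 - r * u n) = r^-1 * u n.+1 - u n by field.
by rewrite r_inv; ring.
Qed.

Lemma deflated_bounded (u : nat -> R) (p : nat -> R) C :
  (forall n, u n.+3 = 3 * u n.+2 + u n.+1 - u n + p n) ->
  (forall n, `|p n| <= C) ->
  forall n, `|u n.+1 - r * u n| <=
    `|u 1%N - r * u 0%N| + `|u 2 - r * u 1%N| + 4 * C.
Proof.
move=> urec pC; move: r_bounds => /andP[rl ru].
have rV0 : 0 <= r^-1 by rewrite invr_ge0; lra.
have rV : r^-1 <= 1 / 3 by rewrite mul1r lef_pV2 ?posrE; lra.
(* Here |3 - r| < 1/4 and 1/r <= 1/3, with sum below 3/4. *)
apply: (contracting_rec_bounded (fun n => u n.+1 - r * u n) `|3 - r| r^-1) => //.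
- by rewrite ltr0_norm; lra.
- exact: le_trans (pC 0%N).
move=> n; rewrite (deflated_rec _ _ urec); apply: le_trans (ler_normD _ _) _.
apply: lerD (pC n); apply: le_trans (ler_normD _ _) _.
by rewrite !normrM (ger0_norm rV0).
Qed.

Lemma ladder_count_ge n : r ^+ n <= m n.+1.
Proof.
move: (r_bounds) => /andP[rl ru].
have f k : `|m k.+2 - r * m k.+1| <= 135 / 100.
  have m3 : m 3 = 22 by rewrite m_rec m0 m1 m2; ring.
  have f1 : `|7 - r * 2| <= 6 / 10 by rewrite ger0_norm; lra.
  have f2 : `|22 - r * 7| <= 75 / 100 by rewrite ler0_norm; lra.
  have : `|m k.+2 - r * m k.+1| <= `|m 2 - r * m 1%N| + `|m 3 - r * m 2| + 4 * 0.
    apply: (deflated_bounded (fun k => m k.+1) (fun=> 0)) => [j|_]; last by rewrite normr0.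
    by rewrite m_rec addr0.
  by rewrite m1 m2 m3; lra.
(* The margin 1 is multiplied by r at each step and so absorbs the error: r - 135/100 >= 1. *)
suff : r ^+ n <= m n.+1 - 1 by lra.
elim: n => [|n IH]; first by rewrite expr0 m1; lra.
have := f n; rewrite ler_norml => /andP[lo _].
have : r * r ^+ n <= r * (m n.+1 - 1) by rewrite ler_wpM2l //; lra.
rewrite exprS; lra.
Qed.

Lemma ladder_mean_bounded :
  exists K, forall n, `|d n.+1 / (n.+1%:R * m n.+1) - c| <= K * n.+1%:R^-1.
Proof.
move: (r_bounds) => /andP[rl ru].
pose F := `|m 1%N - r * m 0%N| + `|m 2 - r * m 1%N| + 4 * 0.
have f k : `|m k.+1 - r * m k| <= F.
  apply: (deflated_bounded m (fun=> 0)) => [j|_]; last by rewrite normr0.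
  by rewrite m_rec addr0.
have F0 : 0 <= F by exact: le_trans (f 0%N).
(* [e] obeys the recurrence of [m] with forcing term [p]: the terms with factor n cancel. *)
pose e n := d n - c * n%:R * m n.
pose p n := (2 * m n.+2 + m n.+1 - 3 * m n) - c * (3 * m n.+2 + 2 * m n.+1 - 3 * m n).
have den : 3 * r ^+ 2 + 2 * r - 3 != 0 by nra.
have erec n : e n.+3 = 3 * e n.+2 + e n.+1 - e n + p n.
  by rewrite /e /p d_rec m_rec -!natr1; ring.
(* The choice of [c] makes r a root of (2 - 3c) X^2 + (1 - 2c) X + 3c - 3. Dividing by X - r writes
   [p] through the bounded differences m n.+1 - r * m n. *)
have pE n : p n = (2 * r + 1 - c * (3 * r + 2)) * (m n.+1 - r * m n)
                  + (2 - c * 3) * (m n.+2 - r * m n.+1).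
  have cE : c * (3 * r ^+ 2 + 2 * r - 3) = 2 * r ^+ 2 + r - 3 by rewrite divfK.
  have : m n * (c * (3 * r ^+ 2 + 2 * r - 3)) = m n * (2 * r ^+ 2 + r - 3) by rewrite cE.
  rewrite /p => E; apply/eqP; rewrite -subr_eq0; apply/eqP.
  transitivity (m n * (2 * r ^+ 2 + r - 3) - m n * (c * (3 * r ^+ 2 + 2 * r - 3))).
    by ring.
  by rewrite E subrr.
pose C := `|2 * r + 1 - c * (3 * r + 2)| * F + `|2 - c * 3| * F.
have pC n : `|p n| <= C.
  rewrite pE; apply: le_trans (ler_normD _ _) _; rewrite !normrM.
  by apply: lerD; rewrite ler_wpM2l.
have eH := deflated_bounded _ _ _ erec pC.
have H0 := le_trans (normr_ge0 _) (eH 0%N).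
move: eH H0; set H := _ + _ + _ => eH H0.
have r2 : 2 <= r by lra.
have eB := linear_growth_bounded _ _ _ r2 H0 eH.
(* The extra factor r arises because e n.+1 is of order r^(n+1) while m n.+1 is only bounded below
   by r^n. *)
exists ((`|e 0%N| + H) * r) => n.
have n0 : 0 < n.+1%:R :> R by rewrite ltr0n.
have mg := ladder_count_ge n.
have rn0 : 0 < r ^+ n by rewrite exprn_gt0; lra.
have mp : 0 < m n.+1 by lra.
have -> : d n.+1 / (n.+1%:R * m n.+1) - c = e n.+1 / m n.+1 * n.+1%:R^-1.
  by rewrite /e; field; rewrite ?(addrC 1) ?natr1 !gt_eqF.
have nV0 : 0 <= n.+1%:R^-1 :> R by rewrite invr_ge0 ltW.
rewrite normrM (ger0_norm nV0); apply: ler_wpM2r => //.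
rewrite normrM normfV (gtr0_norm mp) ler_pdivrMr //.
apply: le_trans (eB n.+1) _; rewrite exprS mulrA; apply: ler_wpM2l => //.
by apply: mulr_ge0; [exact: addr_ge0|lra].
Qed.

End Asymptotics.

From mathcomp Require Import complex.
From mathcomp Require Import all_classical all_reals all_analysis.
Import numFieldNormedType.Exports.
Local Open Scope classical_set_scope.
Local Open Scope ring_scope.
Local Open Scope complex_scope.

(** * The cube roots *)

Section Cardano.
Variable R : realType.
Implicit Types x y t : R.

Lemma powR3V_eq x y : 0 <= y -> y ^+ 3 = x -> x `^ 3^-1 = y.
Proof.
move=> y0 <-; rewrite -powR_mulrn // -powRrM mulfV ?pnatr_eq0 //.
by rewrite powRr1.
Qed.

Lemma cos_triple t : cos (3 * t) = 4 * cos t ^+ 3 - 3 * cos t.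
Proof.
have -> : 3 * t = t *+ 2 + t by ring.
rewrite cosD cos_mulr2n sin_mulr2n.
have := cos2Dsin2 t => E.
have -> : cos t * sin t *+ 2 * sin t = 2 * cos t * (sin t ^+ 2) by ring.
have -> : sin t ^+ 2 = 1 - cos t ^+ 2 by lra.
ring.
Qed.

Lemma cubic_root_principal_cbrt :
  exists2 s : R, 0 < s /\ s ^+ 3 = 4 * s + 2 &
  (1 + s)%:C = 1 + (12 + principal_cbrt (54 * (- 5 + 3 * 'i%C * (Num.sqrt (111 : R))%:C)))
               / (3 * principal_cbrt (27 + 3 * 'i%C * (Num.sqrt (111 : R))%:C)).
Proof.
set q := Num.sqrt (111 : R).
have q2 : q ^+ 2 = 111 by rewrite sqr_sqrtr.
have q0 : 0 <= q by exact: sqrtr_ge0.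
have cartesian (a b c : R) : a%:C + b%:C * 'i%C * c%:C = a +i* (b * c).
  by simpc.
have z1E : 27 + 3 * 'i%C * q%:C = 27 +i* (3 * q).
  by rewrite -cartesian !rmorph_nat.
have z2E : 54 * (- 5 + 3 * 'i%C * q%:C) = (- 270) +i* (162 * q).
  rewrite mulrDr mulrN mulrA mulrA -!natrM -cartesian rmorphN !rmorph_nat.
  by [].
(* The modulus of [w]: 27^2 + 9 * 111 = 12^3 = (h^3)^2. *)
pose h : R := Num.sqrt 12.
have h2 : h ^+ 2 = 12 by rewrite sqr_sqrtr.
have h0 : 0 < h by rewrite sqrtr_gt0.
have m1 : cmod (27 +i* (3 * q)) = h ^+ 3.
  rewrite /cmod (_ : _ + _ = (h ^+ 3) ^+ 2) ?sqrtr_sqr ?ger0_norm ?exprn_ge0 ?ltW //.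
  by rewrite exprMn q2 exprAC h2; ring.
have m2 : cmod ((- 270) +i* (162 * q)) = 12 ^+ 3.
  rewrite /cmod (_ : _ + _ = (12 ^+ 3) ^+ 2) ?sqrtr_sqr ?ger0_norm ?exprn_ge0 //.
  by rewrite exprMn q2; ring.
pose c : R := 27 / h ^+ 3.
have h3 : h ^+ 3 != 0 by rewrite expf_neq0 // gt_eqF.
have c2 : c ^+ 2 = 729 / 1728.
  by rewrite /c expr_div_n exprAC h2; field.
have c0 : 0 < c by rewrite divr_gt0 // exprn_gt0.
have c1 : c < 1 by nra.
have cI : -1 <= c <= 1 by lra.
pose t := acos c.
have [/andP[t0 tpi] ct] : 0 <= t <= pi /\ cos t = c by apply: acos_def.
have pi0 := pi_gt0 R.
(* Thus 2t stays in [0, pi], so it is the principal argument of the second radicand and its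
   principal cube root is exactly w^2. *)
have tpi2 : t <= pi / 2.
  rewrite leNgt; apply/negP => lt.
  have : cos (t - pi / 2 - pi / 2) > 0.
    by apply: cos_gt0_pihalf; lra.
  have -> : t - pi / 2 - pi / 2 = t - pi by field.
  by rewrite cosB cospi sinpi ct; lra.
have t2 : acos (- 270 / 12 ^+ 3) = t *+ 2.
  rewrite -[RHS]cosK; last by rewrite in_itv /=; lra.
  by congr acos; rewrite cos_mulr2n ct c2; field.
pose a := t / 3.
rewrite z1E z2E /principal_cbrt m1 m2 /carg m1 m2 t2 -/c -/t.
(* Both imaginary parts are nonnegative, which selects the branch [acos] in [carg]. *)
rewrite !mulr_ge0 //.
rewrite (@powR3V_eq _ 12) // (@powR3V_eq _ h) ?ltW // -/a.
have -> : t *+ 2 / 3 = a *+ 2 by rewrite mulrnAl.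
pose s := 2 * h * cos a / 3.
have ca : 0 < cos a by apply: cos_gt0_pihalf; rewrite /a; lra.
exists s.
  split; first by rewrite /s !mulr_gt0 // invr_gt0.
  (* The real part h^3 cos (3a) of w^3, expanded by the triple angle formula; with h^2 = 12 it
     becomes the cubic for [s]. *)
  have C3 : 27 = h ^+ 3 * (4 * cos a ^+ 3 - 3 * cos a).
    by rewrite -cos_triple /a mulrCA mulfV ?pnatr_eq0 // mulr1 ct /c; field; lra.
  have : s ^+ 3 = 8 / 27 * (h ^+ 3 * cos a ^+ 3) by rewrite /s; field.
  have : s * 4 = 8 / 27 * (h ^+ 3 * cos a * 3 / 4).
    by rewrite /s exprS h2; field.
  by move: C3; lra.
set w := (h * cos a) +i* (h * sin a).
have -> : (12 * cos (a *+ 2)) +i* (12 * sin (a *+ 2)) = w * w :> R[i].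
  rewrite /w; simpc; rewrite cos_mulr2n sin_mulr2n -h2.
  have E := cos2Dsin2 a.
  have S : sin a ^+ 2 = 1 - cos a ^+ 2 by lra.
  congr (_ +i* _); last by ring.
  have -> : h * cos a * (h * cos a) - h * sin a * (h * sin a)
     = h ^+ 2 * (cos a ^+ 2 - sin a ^+ 2) by ring.
  by rewrite S; ring.
have w0 : w != 0.
  by rewrite eq_complex /= negb_and mulf_neq0 // gt_eqF.
(* 12 = w * conj w, so one factor [w] cancels from the fraction. *)
have -> : 12 = w * ((h * cos a) +i* (- (h * sin a))) :> R[i].
  transitivity ((12 : R)%:C); first by rewrite rmorph_nat.
  rewrite /w; simpc; rewrite -h2; congr (_ +i* _); last by ring.
  rewrite -[LHS]mulr1 -(cos2Dsin2 a); ring.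
rewrite -mulrDr [3 * w]mulrC -mulf_div mulfV // mul1r.
rewrite rmorphD rmorph1; congr (_ + _).
apply: (@mulIf _ 3); first by rewrite pnatr_eq0.
rewrite divfK ?pnatr_eq0 //.
rewrite /w -[3](rmorph_nat (real_complex R)) -rmorphM /s divfK ?pnatr_eq0 //.
by simpc; congr (_ +i* _); ring.
Qed.

End Cardano.

(** * The limit *)

Section LadderRatio.
Variable R : realType.

Definition ladder_poly n : {poly R} := ladder_sum {poly R} 'X n.

Lemma ladder_poly1 n : (ladder_poly n).[1] = (T0 (pendant_graph (ladder n)))%:R.
Proof.
rewrite T0_pendant /ladder_poly ladder_sumE natr_sum horner_sum.
by apply: eq_bigr => M _; rewrite hornerXn expr1n.
Qed.

(** The derivative at 1 sums |M| over the matchings of the ladder, while [T1] sums 2n - |M|. *)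
Lemma ladder_poly_deriv1 n : (ladder_poly n)^`().[1] =
  (2 * n)%:R * (ladder_poly n).[1] - (T1 (pendant_graph (ladder n)))%:R.
Proof.
rewrite T1_pendant natr_sum /ladder_poly ladder_sumE.
rewrite (big_morph _ (@derivD R) (@deriv0 R)) !horner_sum mulr_sumr -sumrB; apply: eq_bigr => M mM.
rewrite derivXn hornerMn !hornerXn !expr1n mulr1 -card_ladder.
by rewrite natrB ?card_leq_matching // subKr.
Qed.

Lemma ladder_poly_rec n : ladder_poly n.+3 =
  (1%:P + 'X *+ 2) * ladder_poly n.+2 + 'X * ladder_poly n.+1 - 'X ^+ 3 * ladder_poly n.
Proof. by rewrite /ladder_poly ladder_sum_rec polyC1 mulr_natl. Qed.

Lemma ladder_poly1_rec n : (ladder_poly n.+3).[1] =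
  3 * (ladder_poly n.+2).[1] + (ladder_poly n.+1).[1] - (ladder_poly n).[1].
Proof.
rewrite ladder_poly_rec !(hornerD, hornerN, hornerM, hornerMn, hornerXn, hornerX, hornerC).
by ring.
Qed.

Lemma ladder_poly_deriv1_rec n : (ladder_poly n.+3)^`().[1] =
  3 * (ladder_poly n.+2)^`().[1] + (ladder_poly n.+1)^`().[1] - (ladder_poly n)^`().[1]
  + (2 * (ladder_poly n.+2).[1] + (ladder_poly n.+1).[1] - 3 * (ladder_poly n).[1]).
Proof.
rewrite ladder_poly_rec !(derivD, derivN, derivM, derivMn, derivXn, derivX, derivC).
rewrite !(hornerD, hornerN, hornerM, hornerMn, hornerXn, hornerX, hornerC).
by ring.
Qed.

Lemma ladder_poly1_init :
  [/\ (ladder_poly 0).[1] = 1, (ladder_poly 1).[1] = 2 & (ladder_poly 2).[1] = 7].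
Proof.
rewrite /ladder_poly /ladder_sum /= -!(polyC1 R) !(hornerD, hornerM, hornerX, hornerC).
by split; ring.
Qed.

(** The index [n.+1] keeps [nu] nonzero; [T0] is nonzero because the empty matching extends to a
    maximal one. *)
Lemma Iratio_ladder n : Iratio (pendant_graph (ladder n.+1)) R =
  1 - (ladder_poly n.+1)^`().[1] / (n.+1%:R * (ladder_poly n.+1).[1]) / 2.
Proof.
have m0 : (ladder_poly n.+1).[1] != 0.
  rewrite ladder_poly1 pnatr_eq0 cards_eq0; apply/finset.set0Pn.
  have [N maxN _] := maxset_exists (matching0 (pendant_graph (ladder n.+1))).
  by exists N; rewrite finset.in_set; exact: maxN.
rewrite /Iratio nu_pendant card_ladder muln_eq0 /=.
rewrite -ladder_poly1 ladder_poly_deriv1; move: m0; set a := _.[1]; set b := _%:R => m0.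
by rewrite natrM; field; rewrite m0 addrC natr1 pnatr_eq0.
Qed.

End LadderRatio.

Theorem theorem10 (R : realType) :
  exists r : R,
    r%:C = 1 + (12 + principal_cbrt (54 * (- 5 + 3 * 'i%C * (Num.sqrt (111 : R))%:C)))
               / (3 * principal_cbrt (27 + 3 * 'i%C * (Num.sqrt (111 : R))%:C))
    /\ Iratio (pendant_graph (ladder n)) R @[n --> \oo] -->
         (4 * r ^+ 2 + 3 * r - 3) / (2 * (3 * r ^+ 2 + 2 * r - 3)).
Proof.
have [s [s0 s3] sE] := cubic_root_principal_cbrt R.
exists (1 + s); split=> //; set r := 1 + s.
have [m0 m1 m2] := ladder_poly1_init R.
have [K HK] := ladder_mean_bounded R (fun n => (ladder_poly R n).[1])
  (fun n => (ladder_poly R n)^`().[1]) s s0 s3 m0 m1 m2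
  (ladder_poly1_rec R) (ladder_poly_deriv1_rec R).
have den : 3 * r ^+ 2 + 2 * r - 3 != 0 by rewrite gt_eqF // /r; nra.
set L := _ / _.
have LE : L = 1 - (2 * r ^+ 2 + r - 3) / (3 * r ^+ 2 + 2 * r - 3) / 2 by rewrite /L; field.
(* After the shift, [harmonic n] is exactly the factor 1/(n+1) of the error bound; K/2 reflects the
   halving in [Iratio_ladder]. *)
rewrite -cvg_shiftS /=.
have Lharm (k : R) : L + k * harmonic n @[n --> \oo] --> L.
  rewrite -[X in _ --> X]addr0 -(mulr0 k).
  by apply: cvgD; [exact: cvg_cst|apply: cvgMr; exact: cvg_harmonic].
apply: squeeze_cvgr (Lharm (- (K / 2))) (Lharm (K / 2)).
near=> n; have := HK n; rewrite -/r Iratio_ladder LE /= ler_norml => /andP[].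
rewrite mulNr [K / 2 / _]mulrAC; set u := _ / (_ * _); set k := K / _; set c := _ / _.
by move=> lo hi; apply/andP; split; lra.
Unshelve. all: by end_near.
Qed.
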